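(* (1) Consider the self-aggregation $[\lambda]+[\lambda]\to[\nu]$ of a partition $\lambda=(\lambda_1,\lambda_2)$, where $\lambda_1>\lambda_2+3$. Then the highest probability weight result is $\nu=(\lambda_1+\lambda_2,\lambda_1)$. (2) Let $\lambda^{(1)}=(\lambda_1,\lambda_2)$ be a partition with $\lambda_1>\lambda_2+3$. Consider a sequence of self-aggregations of partitions $$[\lambda^{(N)}]+[\lambda^{(N)}]\to[\lambda^{(N+1)}],\qquad N=1,2,\dots,$$ where on each step the highest probability weight result is picked as $\lambda^{(N+1)}$ for the next step of aggregation. Then the shape of the rectangle $\lambda^{(N)}$ tends to the ''golden rectangle'': $$\lim_{N\to\infty}\frac{\lambda^{(N)}_1}{\lambda^{(N)}_2}=\varphi=\frac{1+\sqrt5}{2}\simeq 1.6180,$$ and the transitional probabilities of the sequence have the limit $$\lim_{N\to\infty}P_{\lambda^{(N)},\lambda^{(N)}}^{\lambda^{(N+1)}}=\frac12-\frac{1}{\varphi+1}\simeq 0.1180.$$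
   Context: Here partitions have length $2$: $\lambda=(\lambda_1,\lambda_2)$ with integers $\lambda_1\ge\lambda_2>0$. A two-dimensional box (rectangle) is an ordered pair $x=(x_1,x_2)\in\mathbb{Z}_{>0}^2$, realized as an axis-parallel rectangle in $\mathbb{R}^2$ with side lengths $x_1,x_2$ and vertices in $\mathbb{Z}^2$. For a partition $\lambda$, $[\lambda]$ denotes the set of distinct boxes obtained by permuting the coordinates of $\lambda$, i.e. $\{(\lambda_1,\lambda_2),(\lambda_2,\lambda_1)\}$. Attachments of boxes $x$ and $y$: keep the box $x$ in a fixed position and translate the box $y$ (without rotation) by lattice vectors. A position of $y$ is an attachment if the two boxes are placed next to each other (disjoint interiors) and their boundaries have at least one common lattice point. The result of the aggregation is the box $z$ given by the side lengths of the minimal axis-aligned bounding box of the union; one writes $x+y\to z$. Aggregation of partitions: $[\lambda]+[\mu]\to[\nu]$ if $x+y\to z$ for some $x\in[\lambda]$, $y\in[\mu]$, $z\in[\nu]$. The transitional probability $P_{\lambda,\mu}^{\nu}$ is defined by fixing a representative $x\in[\lambda]$, considering all attachments of $x$ and $y$ for all $y\in[\mu]$, and dividing the number of those attachments whose result $z$ lies in $[\nu]$ by the total number of these attachments. Self-aggregation is the case $\mu=\lambda$. A partition $\nu$ is a highest probability weight result (most frequent transition) of the aggregation of $\lambda$ and $\mu$ if $P_{\lambda,\mu}^{\nu}$ is maximal over all possible results $[\lambda]+[\mu]\to[\nu]$.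
   Formalization: Part (2) is false for λ₂=1 (from (5,1) the results are (6,5),(11,10),(21,20),…, ratio → 1) and, through ties, for λ₂=2; it is proved for λ₂≥3, and for every λ₂ for the sequence λ^(N+1)=(λ₁^(N)+λ₂^(N), λ₁^(N)). *)

(* Defs.v *)
From HB Require Import structures.
From mathcomp Require Import all_boot all_order all_algebra.
From mathcomp Require Import finmap.
From mathcomp Require Import all_classical all_reals all_analysis.

Import Order.TTheory GRing.Theory Num.Theory.
Import numFieldNormedType.Exports.

Local Open Scope classical_set_scope.
Local Open Scope ring_scope.

(* Partitions of length 2 and side lengths of boxes are both pairs of natural
   numbers; [is_partition] singles out the partitions. *)
Definition is_partition (l : nat * nat) : Prop := (0 < l.2 <= l.1)%N.

(* The class [l] of boxes; a set, so the two boxes coincide when l.1 = l.2. *)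
Definition boxes (l : nat * nat) : set (nat * nat) :=
  [set x | x = l \/ x = (l.2, l.1)].

(* The closed axis-parallel rectangle with lower left corner c and side
   lengths s. *)
Definition rectangle {R : realType} (c s : R * R) : set (R * R) :=
  [set q | c.1 <= q.1 <= c.1 + s.1 /\ c.2 <= q.2 <= c.2 + s.2].

Definition lattice_point (R : realType) (t : int * int) : R * R :=
  (t.1%:~R, t.2%:~R).

Definition sides (R : realType) (x : nat * nat) : R * R :=
  (x.1%:R, x.2%:R).

(* The box x translated so that its lower left corner is t. *)
Definition box_at (R : realType) (t : int * int) (x : nat * nat) :
    set (R * R) :=
  rectangle (lattice_point R t) (sides R x).

Definition boundary {R : realType} (A : set (R * R)) : set (R * R) :=
  closure A `\` A°.

(* The box x is fixed with its lower left corner at the origin, and a position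
   of y is the lattice point t where its lower left corner is placed.  Corner
   contacts count as attachments. *)
Definition attachment (R : realType) (x y : nat * nat) (t : int * int) : Prop :=
  (box_at R (0, 0) x)° `&` (box_at R t y)° = set0 /\
  exists u : int * int,
    boundary (box_at R (0, 0) x) (lattice_point R u) /\
    boundary (box_at R t y) (lattice_point R u).

(* z gives the side lengths of the least axis-parallel rectangle containing
   A. *)
Definition bounding_box {R : realType} (A : set (R * R)) (z : nat * nat) :
    Prop :=
  exists c : R * R,
    A `<=` rectangle c (sides R z) /\
    forall c' s' : R * R,
      A `<=` rectangle c' s' -> rectangle c (sides R z) `<=` rectangle c' s'.

(* z is the result of the aggregation of x with y placed at t. *)
Definition result_at (R : realType) (x y : nat * nat) (t : int * int)
    (z : nat * nat) : Prop :=
  bounding_box (box_at R (0, 0) x `|` box_at R t y) z.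

(* [l] + [m] -> [n] *)
Definition aggregates (R : realType) (l m n : nat * nat) : Prop :=
  exists x y z : nat * nat, exists t : int * int,
    [/\ boxes l x, boxes m y, boxes n z, attachment R x y t
      & result_at R x y t z].

(* All attachments of the representative l of [l] with the boxes y of [m],
   recorded as pairs (y, t) with t the position of y. *)
Definition attachments (R : realType) (l m : nat * nat) :
    set ((nat * nat) * (int * int)) :=
  [set a | boxes m a.1 /\ attachment R l a.1 a.2].

Definition attachments_to (R : realType) (l m n : nat * nat) :
    set ((nat * nat) * (int * int)) :=
  [set a | attachments R l m a /\
           exists z, boxes n z /\ result_at R l a.1 a.2 z].

(* Both sets are finite, so [fset_set] does not fall back to the empty set. *)
Definition transition_prob (R : realType) (l m n : nat * nat) : R :=
  #|` fset_set (attachments_to R l m n)|%:R /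
  #|` fset_set (attachments R l m)|%:R.

Definition highest_result (R : realType) (l m n : nat * nat) : Prop :=
  [/\ is_partition n, aggregates R l m n &
      forall n', is_partition n' -> aggregates R l m n' ->
        transition_prob R l m n' <= transition_prob R l m n].

Definition golden_ratio (R : realType) : R := (1 + Num.sqrt 5) / 2.

Definition golden_limits (R : realType) (s : nat -> nat * nat) : Prop :=
  ((fun N : nat => (s N).1%:R / (s N).2%:R : R) @ \oo --> golden_ratio R) /\
  ((fun N : nat => transition_prob R (s N) (s N) (s N.+1)) @ \oo
     --> 1 / 2 - 1 / (golden_ratio R + 1)).

(* Main.v *)
(* Fix the box (a, b), b < a, with its lower left corner at the origin.  A box
   (c, d) attaches to it exactly when its lower left corner is a lattice point
   of the boundary of [-c, a] x [-d, b], which has 2 (a + b + c + d) of them;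
   so there are 8 (a + b) attachments.  At most 4 positions of the unrotated
   copy lead to a given result.  The rotated copy (b, a) leads to (a + b, a)
   whenever it slides along a side without protruding, in 4 (a - b + 1)
   positions, and to any other result in at most 8 positions.  Hence (a + b, a)
   is the unique most frequent result as soon as 4 (a - b + 1) > 12, that is
   a >= b + 3, and this condition is inherited by (a + b, a) when b >= 3.
   The ratio r = a / b then evolves by r |-> 1 + 1 / r, which contracts to the
   golden ratio, and the probability is (a - b) / (2 (a + b)) + O(1 / b). *)
Require Import Defs.
From mathcomp Require Import all_boot all_order all_algebra finmap.
From mathcomp Require Import all_classical all_reals all_analysis.
From mathcomp Require Import zify ring lra.
Import Order.TTheory GRing.Theory Num.Theory.
Import numFieldNormedType.Exports.
Local Open Scope classical_set_scope.
Local Open Scope ring_scope.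

(** * Interiors of products, and casts of integer extrema *)

Lemma interior_setX (T U : topologicalType) (A : set T) (B : set U) :
  (A `*` B)° = A° `*` B°.
Proof.
apply/seteqP; split=> -[x y].
- move=> [[P Q] /= [xP yQ] PQ]; split=> /=.
  + apply: filterS xP => a Pa.
    by have [] := PQ (a, y) (conj Pa (nbhs_singleton yQ)).
  + apply: filterS yQ => b Qb.
    by have [] := PQ (x, b) (conj (nbhs_singleton xP) Qb).
- by move=> [xA yB]; exists (A, B).
Qed.

Lemma intr_min (R : numDomainType) (m n : int) :
  (Order.min m n)%:~R = Order.min m%:~R n%:~R :> R.
Proof. by rewrite !minElt ltr_int; case: ifP. Qed.

Lemma intr_max (R : numDomainType) (m n : int) :
  (Order.max m n)%:~R = Order.max m%:~R n%:~R :> R.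
Proof. by rewrite !maxElt ltr_int; case: ifP. Qed.

(** * Real rectangles reduced to integer inequalities *)

Section rectangle.
Variable R : realType.
Implicit Types (c s q : R * R) (t u : int * int) (x y z : nat * nat).

Lemma rectangleE c s :
  rectangle c s = `[c.1, c.1 + s.1] `*` `[c.2, c.2 + s.2].
Proof. by apply/seteqP; split=> q /=; rewrite !in_itv. Qed.

Lemma interior_rectangle c s :
  (rectangle c s)° =
  [set q | c.1 < q.1 < c.1 + s.1 /\ c.2 < q.2 < c.2 + s.2].
Proof.
rewrite rectangleE interior_setX !interior_itv.
by apply/seteqP; split=> q /=; rewrite !in_itv.
Qed.

Lemma closed_rectangle c s : closed (rectangle c s).
Proof.
rewrite rectangleE.
have -> : `[c.1, c.1 + s.1] `*` `[c.2, c.2 + s.2] =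
    fst @^-1` `[c.1, c.1 + s.1] `&` snd @^-1` `[c.2, c.2 + s.2] by [].
by apply: closedI; apply: closed_comp (interval_closed _ _) => // q _;
  [exact: cvg_fst | exact: cvg_snd].
Qed.

Lemma boundary_rectangle c s :
  boundary (rectangle c s) = rectangle c s `\` (rectangle c s)°.
Proof. by rewrite /boundary -(closure_id _).1 //; exact: closed_rectangle. Qed.

Lemma lattice_in_box t x u :
  box_at R t x (lattice_point R u) <->
  (t.1 <= u.1 <= t.1 + x.1%:Z) /\ (t.2 <= u.2 <= t.2 + x.2%:Z).
Proof.
by rewrite /box_at /rectangle /= !pmulrn -!intrD !ler_int.
Qed.

Lemma lattice_in_box_interior t x u :
  (box_at R t x)° (lattice_point R u) <->
  (t.1 < u.1 < t.1 + x.1%:Z) /\ (t.2 < u.2 < t.2 + x.2%:Z).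
Proof.
by rewrite interior_rectangle /= !pmulrn -!intrD !ltr_int.
Qed.

Lemma open_itv_meet (k l m n : int) :
  (exists r : R, k%:~R < r < l%:~R /\ m%:~R < r < n%:~R) <->
  Order.max k m < Order.min l n.
Proof.
split=> [[r [/andP[kr rl] /andP[mr rn]]]|kmln].
  rewrite lt_min !gt_max -!(ltr_int R).
  by rewrite (lt_trans kr rl) (lt_trans mr rl) (lt_trans kr rn) (lt_trans mr rn).
exists (((Order.max k m)%:~R + (Order.min l n)%:~R) / 2).
have [] : k <= Order.max k m /\ m <= Order.max k m by lia.
have [] : Order.min l n <= l /\ Order.min l n <= n by lia.
move: kmln; rewrite -!(ltr_int R) -!(ler_int R); lra.
Qed.

(** The two ranges say that the closed boxes meet. Within them, the last clause keeps [t] out of the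
    open rectangle of positions where the interiors overlap. *)
Lemma attachmentE x y t :
  (0 < x.1)%N -> (0 < x.2)%N -> (0 < y.1)%N -> (0 < y.2)%N ->
  attachment R x y t <->
  [/\ - y.1%:Z <= t.1 <= x.1%:Z, - y.2%:Z <= t.2 <= x.2%:Z
    & [|| t.1 == - y.1%:Z, t.1 == x.1%:Z, t.2 == - y.2%:Z | t.2 == x.2%:Z]].
Proof.
case: x y t => [a b] [c d] [t1 t2] /= a0 b0 c0 d0.
have meetP : (box_at R (0, 0) (a, b))° `&` (box_at R (t1, t2) (c, d))° = set0 <->
    ~ (Order.max 0 t1 < Order.min a%:Z (t1 + c%:Z) /\
       Order.max 0 t2 < Order.min b%:Z (t2 + d%:Z)).
  rewrite -!open_itv_meet !interior_rectangle /= !add0r !intrD; split.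
  - move=> disj [[r [r1 r2]] [r' [r1' r2']]].
    by suff : set0 (r, r') by []; rewrite -disj.
  - move=> nmeet; apply/seteqP; split=> // -[r r'] /= [[h1 h2] [h3 h4]].
    by apply: nmeet; split; [exists r | exists r'].
rewrite /attachment meetP; split.
- move=> [ndisj [[u1 u2]]]; rewrite !boundary_rectangle.
  by move=> [[/lattice_in_box /= hu _] [/lattice_in_box /= hv _]]; split; lia.
- move=> [h1 h2 h3]; split; first lia.
  (* The lower left corner of the intersection of the two closed boxes. *)
  exists (Order.max 0 t1, Order.max 0 t2); rewrite !boundary_rectangle.
  by split; split; try apply/lattice_in_box;
    try move/lattice_in_box_interior; rewrite /=; lia.
Qed.

Lemma rectangle_sub c s c' s' : 0 <= s.1 -> 0 <= s.2 ->
  (rectangle c s `<=` rectangle c' s') <->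
  [/\ c'.1 <= c.1, c'.2 <= c.2, c.1 + s.1 <= c'.1 + s'.1
    & c.2 + s.2 <= c'.2 + s'.2].
Proof.
move=> s1 s2; split=> [sub|[h1 h2 h3 h4] q [/andP[q1 q2] /andP[q3 q4]]].
- have /sub[/= /andP[? _] /andP[? _]] : rectangle c s c.
    by split; rewrite lexx lerDl.
  have /sub[/= /andP[_ ?] /andP[_ ?]] : rectangle c s (c.1 + s.1, c.2 + s.2).
    by split; rewrite lexx lerDl andbT.
  by split.
- by split; apply/andP; split; [exact: le_trans q1|exact: le_trans h3|
    exact: le_trans q3|exact: le_trans h4].
Qed.

Lemma result_atE x y t z :
  result_at R x y t z <->
  z.1%:Z = Order.max x.1%:Z (t.1 + y.1%:Z) - Order.min 0 t.1 /\
  z.2%:Z = Order.max x.2%:Z (t.2 + y.2%:Z) - Order.min 0 t.2.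
Proof.
pose m1 := Order.min 0 t.1; pose m2 := Order.min 0 t.2.
pose M1 := Order.max x.1%:Z (t.1 + y.1%:Z).
pose M2 := Order.max x.2%:Z (t.2 + y.2%:Z).
pose c0 : R * R := (m1%:~R, m2%:~R).
pose s0 : R * R := ((M1 - m1)%:~R, (M2 - m2)%:~R).
have [s1 s2] : 0 <= s0.1 /\ 0 <= s0.2.
  by rewrite /= !ler0z /M1 /M2 /m1 /m2; split; lia.
have subE c' s' : box_at R (0, 0) x `|` box_at R t y `<=` rectangle c' s' <->
    rectangle c0 s0 `<=` rectangle c' s'.
  rewrite subUset !rectangle_sub ?ler0n //= !add0r !pmulrn -!intrD.
  rewrite ![_ + (_ - _)]addrC !subrK /m1 /m2 /M1 /M2 !intr_min !intr_max.
  rewrite !le_min !ge_max; split=> [[[-> -> -> ->] [-> -> -> ->]] //|].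
  by move=> [/andP[-> ->] /andP[-> ->] /andP[-> ->] /andP[-> ->]].
rewrite /result_at /bounding_box -/M1 -/M2 -/m1 -/m2; split.
- move=> [c [/subE sub least]].
  have := least c0 s0 ((subE c0 s0).2 (fun _ => id)).
  move: sub; rewrite !rectangle_sub ?ler0n //= => -[h1 h2 h3 h4] [h5 h6 h7 h8].
  by split; apply/eqP; rewrite -(eqr_int R) -!pmulrn eq_le; lra.
- move=> [z1 z2]; exists c0.
  have <- : s0 = sides R z by rewrite /s0 /sides -z1 -z2.
  by split; [exact/subE | move=> c' s' /subE].
Qed.

End rectangle.

(** * Cardinality bounds from explicit sequences *)

Section card_fset_set_seq.
Variables (T : choiceType) (A : set T) (s : seq T).

Lemma finite_sub_seq : (forall x, A x -> x \in s) -> finite_set A.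
Proof. by move=> As; apply: sub_finite_set (finite_seq s) => x /As. Qed.

Lemma card_fset_set_le_size :
  (forall x, A x -> x \in s) -> (#|` fset_set A| <= size s)%N.
Proof.
move=> As; apply: uniq_leq_size (fset_uniq _) _ => x.
by rewrite in_fset_set ?inE; [exact: As | exact: finite_sub_seq].
Qed.

(** Finiteness must be supplied here, because [fset_set] sends an infinite set to the empty one. *)
Lemma size_le_card_fset_set :
  finite_set A -> uniq s -> (forall x, x \in s -> A x) ->
  (size s <= #|` fset_set A|)%N.
Proof.
move=> finA us sA; apply: uniq_leq_size us _ => x xs.
by rewrite in_fset_set // inE; exact: sA.
Qed.

Lemma card_fset_set_seq :
  uniq s -> (forall x, A x <-> x \in s) -> #|` fset_set A| = size s.
Proof.
move=> us As; apply/eqP; rewrite eqn_leq card_fset_set_le_size => [|x /As //].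
apply: size_le_card_fset_set => // [|x /As //].
by apply: finite_sub_seq => x /As.
Qed.

End card_fset_set_seq.

(** * Integer ranges, grids and frames *)

Definition int_range (m : int) (n : nat) : seq int :=
  [seq m + i%:Z | i <- iota 0 n].

Lemma mem_int_range m n k : (k \in int_range m n) = (m <= k < m + n%:Z).
Proof.
apply/mapP/idP => [[i]|mk]; first by rewrite mem_iota => ? ->; lia.
by exists `|k - m|%N; rewrite ?mem_iota; lia.
Qed.

Lemma int_range_uniq m n : uniq (int_range m n).
Proof. by rewrite map_inj_uniq ?iota_uniq // => i j /addrI []. Qed.

Lemma size_int_range m n : size (int_range m n) = n.
Proof. by rewrite size_map size_iota. Qed.

Lemma mem_grid (u v : seq int) (t : int * int) :
  (t \in [seq (p, q) | p <- u, q <- v]) = (t.1 \in u) && (t.2 \in v).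
Proof.
case: t => p q; apply/allpairsP/andP => [[[? ?] [? ? [-> ->]]] //|[? ?]].
by exists (p, q).
Qed.

Lemma grid_uniq (u v : seq int) :
  uniq u -> uniq v -> uniq [seq (p, q) | p <- u, q <- v].
Proof. by move=> uu uv; apply: allpairs_uniq => // -[? ?] [? ?]. Qed.

Lemma mem_pair_map (y y' : nat * nat) (t : int * int) (s : seq (int * int)) :
  ((y, t) \in map (pair y') s) = (y == y') && (t \in s).
Proof.
apply/mapP/andP => [[t' t's [-> ->]] //|[/eqP-> ?]]; last by exists t.
Qed.

Lemma pair_map_inj_uniq (y : nat * nat) (s : seq (int * int)) :
  uniq (map (pair y) s) = uniq s.
Proof. by apply: map_inj_uniq => ? ? []. Qed.

(* The lattice points of the boundary of [-c, a] x [-d, b]. *)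
Definition frame (a b c d : nat) : seq (int * int) :=
  [seq (p, q) | p <- [:: - c%:Z; a%:Z], q <- int_range (- d%:Z) (b + d).+1] ++
  [seq (p, q) | p <- int_range (1 - c%:Z) (a + c).-1, q <- [:: - d%:Z; b%:Z]].

Lemma frame_uniq a b c d :
  (0 < a)%N -> (0 < b)%N -> (0 < c)%N -> (0 < d)%N -> uniq (frame a b c d).
Proof.
move=> a0 b0 c0 d0; rewrite cat_uniq; apply/and3P; split.
- by rewrite grid_uniq ?int_range_uniq //= !inE; lia.
(* The horizontal sides omit the four corners, which the vertical sides already list. *)
- by apply/hasPn => t; rewrite !mem_grid !mem_int_range !inE; lia.
- by rewrite grid_uniq ?int_range_uniq //= !inE; lia.
Qed.

Lemma size_frame a b c d :
  (0 < a)%N -> size (frame a b c d) = (2 * (a + b + c + d))%N.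
Proof. by move=> a0; rewrite size_cat !size_allpairs !size_int_range /=; lia. Qed.

Lemma attachment_frame (R : realType) (x y : nat * nat) (t : int * int) :
  (0 < x.1)%N -> (0 < x.2)%N -> (0 < y.1)%N -> (0 < y.2)%N ->
  attachment R x y t <-> t \in frame x.1 x.2 y.1 y.2.
Proof.
move=> x1 x2 y1 y2; rewrite attachmentE //.
rewrite mem_cat !mem_grid !mem_int_range !inE; split=> [[]|] => *; last split; lia.
Qed.

(** * Counting attachments and finding the most frequent result *)

Section self_aggregation.
Variables (R : realType) (a b : nat).
Hypotheses (b0 : (0 < b)%N) (ba : (b < a)%N).

Let a0 : (0 < a)%N. Proof. exact: leq_trans ba. Qed.

Definition all_positions : seq ((nat * nat) * (int * int)) :=
  map (pair (a, b)) (frame a b a b) ++ map (pair (b, a)) (frame a b b a).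

Lemma attachmentsP p : attachments R (a, b) (a, b) p <-> p \in all_positions.
Proof.
case: p => y t; rewrite mem_cat !mem_pair_map; split.
- by move=> [/= [->|->] /attachment_frame/= -> //]; rewrite eqxx ?orbT.
- by case/orP => /andP[/eqP-> tf]; split; rewrite /=;
    [left | apply/attachment_frame | right | apply/attachment_frame].
Qed.

Lemma card_attachments :
  #|` fset_set (attachments R (a, b) (a, b))| = (8 * (a + b))%N.
Proof.
rewrite (@card_fset_set_seq _ _ all_positions); last exact: attachmentsP.
  by rewrite size_cat !size_map !size_frame //; lia.
rewrite cat_uniq; apply/and3P; split; rewrite ?pair_map_inj_uniq ?frame_uniq //.
(* As [b < a], the tags [(a, b)] and [(b, a)] differ, so the halves are disjoint. *)
apply/hasPn => -[y t]; rewrite !mem_pair_map => /andP[/eqP-> _].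
by rewrite xpair_eqE; lia.
Qed.

(* Contains the positions of the copy (a, b) of the box whose result is n: a copy on the
   left or right gives (2a, b + |t.2|), one below or above (a + |t.1|, 2b). *)
Definition same_positions (n : nat * nat) : seq (int * int) :=
  let signed u v := [seq (p, q) | p <- [:: u; - u], q <- [:: v; - v]] in
  if n.1 == (2 * a)%N then signed a%:Z (n.2%:Z - b%:Z)
  else if n.1 == (2 * b)%N then signed (n.2%:Z - a%:Z) b%:Z
  else signed (n.1%:Z - a%:Z) b%:Z.

(** A copy on the left or right has height at most [2b < 2a], so the first test catches it. For a
    copy above or below, the second test decides which part of [n] is [2b]. *)
Lemma attachments_to_same n t : is_partition n ->
  attachments_to R (a, b) (a, b) n ((a, b), t) -> t \in same_positions n.
Proof.
case: n t => [n1 n2] [t1 t2]; rewrite /is_partition /= => n21.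
move=> [[_ /attachmentE[]//= h1 h2 h3] [[z1 z2] [zn /result_atE[/= r1 r2]]]].
have {}zn : (z1 = n1 /\ z2 = n2) \/ (z1 = n2 /\ z2 = n1).
  by case: zn => -[-> ->]; [left|right].
rewrite /same_positions /=.
by case: eqP => ?; [|case: eqP => ?]; rewrite !inE !xpair_eqE; lia.
Qed.

(* Contains the positions of the rotated box (b, a) whose result is n.  Sliding along a
   side without protruding always gives the class of (a + b, a). *)
Definition swapped_positions (n : nat * nat) : seq (int * int) :=
  if n == ((a + b)%N, a) then
    [seq (p, q) | p <- [:: - b%:Z; a%:Z],
                  q <- int_range (b%:Z - a%:Z) (a - b).+1] ++
    [seq (p, q) | p <- int_range 0 (a - b).+1, q <- [:: - a%:Z; b%:Z]]
  else
    [seq (p, q) | p <- [:: - b%:Z; a%:Z],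
                  q <- [:: n.2%:Z - a%:Z; b%:Z - n.2%:Z]] ++
    [seq (p, q) | p <- [:: a%:Z - n.2%:Z; n.2%:Z - b%:Z],
                  q <- [:: - a%:Z; b%:Z]].

(** The larger part of the result is always [a + b]. When the other part is not [a], the copy
    protrudes at one end, and that part determines by how much. *)
Lemma attachments_to_swapped n t : is_partition n ->
  attachments_to R (a, b) (a, b) n ((b, a), t) -> t \in swapped_positions n.
Proof.
case: n t => [n1 n2] [t1 t2]; rewrite /is_partition /= => n21.
move=> [[_ /attachmentE[]//= h1 h2 h3] [[z1 z2] [zn /result_atE[/= r1 r2]]]].
have {}zn : (z1 = n1 /\ z2 = n2) \/ (z1 = n2 /\ z2 = n1).
  by case: zn => -[-> ->]; [left|right].
rewrite /swapped_positions xpair_eqE.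
case: ifPn => ?; last by rewrite mem_cat !mem_grid !inE /=; lia.
by rewrite mem_cat !mem_grid !mem_int_range !inE /=; lia.
Qed.

(** The converse inclusion, on which the lower bound for the dominant result rests. *)
Lemma attachments_to_max t :
  t \in swapped_positions ((a + b)%N, a) ->
  attachments_to R (a, b) (a, b) ((a + b)%N, a) ((b, a), t).
Proof.
rewrite /swapped_positions eqxx mem_cat !mem_grid !mem_int_range !inE.
case: t => t1 t2 /= ht; split.
  by split; [right | apply/attachmentE => //=; split; lia].
case/orP: ht => ht.
- exists ((a + b)%N, a); split; first by left.
  by apply/result_atE => /=; lia.
- exists (a, (a + b)%N); split; first by right.
  by apply/result_atE => /=; lia.
Qed.

Lemma finite_attachments_to n :
  finite_set (attachments_to R (a, b) (a, b) n).
Proof.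
by apply: (@finite_sub_seq _ _ all_positions) => p [/attachmentsP].
Qed.

Lemma card_attachments_to n : is_partition n ->
  (#|` fset_set (attachments_to R (a, b) (a, b) n)|
     <= 4 + size (swapped_positions n))%N.
Proof.
move=> np; have <- : size (same_positions n) = 4%N.
  by rewrite /same_positions; case: ifP => // _; case: ifP.
pose s := map (pair (a, b)) (same_positions n) ++
  map (pair (b, a)) (swapped_positions n).
have <- : size s = (size (same_positions n) + size (swapped_positions n))%N.
  by rewrite size_cat !size_map.
apply: card_fset_set_le_size => -[y t] yt.
rewrite mem_cat !mem_pair_map; have [[/= yl _] _] := yt.
case: yl yt => -> yt.
- by rewrite eqxx attachments_to_same.
- by rewrite eqxx attachments_to_swapped ?orbT.
Qed.

Lemma size_swapped_positions_max :
  size (swapped_positions ((a + b)%N, a)) = (4 * (a - b + 1))%N.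
Proof.
by rewrite /swapped_positions eqxx size_cat !size_allpairs !size_int_range /=; lia.
Qed.

(** Rotated copies alone give the lower bound; the upper one allows for four unrotated copies. The
    slack vanishes in the limit. *)
Lemma card_attachments_to_max :
  (4 * (a - b + 1) <= #|` fset_set (attachments_to R (a, b) (a, b) ((a + b)%N, a))|
     <= 4 * (a - b + 1) + 4)%N.
Proof.
apply/andP; split; last first.
  rewrite -size_swapped_positions_max [leqRHS]addnC; apply: card_attachments_to.
  by rewrite /is_partition /=; lia.
rewrite -size_swapped_positions_max -(size_map (pair (b, a))).
apply: size_le_card_fset_set; first exact: finite_attachments_to.
- rewrite pair_map_inj_uniq /swapped_positions eqxx cat_uniq.
  apply/and3P; split.
  + by rewrite grid_uniq ?int_range_uniq //= !inE; lia.
  + by apply/hasPn => t; rewrite !mem_grid !mem_int_range !inE; lia.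
  + by rewrite grid_uniq ?int_range_uniq //= !inE; lia.
- by move=> _ /mapP[t + ->]; exact: attachments_to_max.
Qed.

Lemma card_attachments_to_other n : is_partition n -> n <> ((a + b)%N, a) ->
  (#|` fset_set (attachments_to R (a, b) (a, b) n)| <= 12)%N.
Proof.
move=> np /eqP/negPf ne; apply: leq_trans (card_attachments_to _ np) _.
by rewrite /swapped_positions ne.
Qed.

Lemma highest_resultE n : (b + 3 <= a)%N ->
  highest_result R (a, b) (a, b) n <-> n = ((a + b)%N, a).
Proof.
move=> ba3.
have max_part : is_partition ((a + b)%N, a) by rewrite /is_partition /=; lia.
have max_aggr : aggregates R (a, b) (a, b) ((a + b)%N, a).
  exists (a, b), (b, a), ((a + b)%N, a), (a%:Z, 0).
  split; [by left | by right | by left | |].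
  - by apply/attachmentE => //=; split; lia.
  - by apply/result_atE => /=; lia.
(* Strictness yields uniqueness along with maximality. *)
have max_gt n' : is_partition n' -> n' <> ((a + b)%N, a) ->
    transition_prob R (a, b) (a, b) n' <
    transition_prob R (a, b) (a, b) ((a + b)%N, a).
  move=> n'p n'max; rewrite /transition_prob card_attachments.
  rewrite ltr_pM2r ?invr_gt0 ?ltr0n ?ltr_nat; last by lia.
  apply: leq_ltn_trans (card_attachments_to_other _ n'p n'max) _.
  by case/andP: card_attachments_to_max => + _; lia.
split=> [[np _ nmax]|->].
- apply: contrapT => nnmax.
  by have := nmax _ max_part max_aggr; rewrite leNgt max_gt.
- split=> // n' n'p _.
  have [->//|nnmax] := pselect (n' = ((a + b)%N, a)).
  exact/ltW/max_gt.
Qed.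

End self_aggregation.

(** * Convergence of the ratio and of the probabilities *)

Section golden_ratio.
Variable R : realType.
Local Notation phi := (golden_ratio R).

Lemma golden_ratio_sqr : phi * phi = phi + 1.
Proof.
have := sqr_sqrtr (ler0n R 5); rewrite /golden_ratio; set r := Num.sqrt 5.
by rewrite expr2 => r5; lra.
Qed.

Lemma golden_ratio_gt : 3 / 2 < phi.
Proof.
have r0 := sqrtr_ge0 (5 : R).
have := sqr_sqrtr (ler0n R 5); rewrite expr2 /golden_ratio.
set r := Num.sqrt 5 in r0 *; nra.
Qed.

Section iteration.
Variable u : nat -> nat * nat.
Hypotheses (u0 : (0 < (u 0%N).2 < (u 0%N).1)%N)
  (uS : forall N, u N.+1 = (((u N).1 + (u N).2)%N, (u N).1)).

(** Linear growth is crude, but enough to bound the error in the probability by [harmonic N]. *)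
Lemma iteration_bound N : (N < (u N).2 < (u N).1)%N.
Proof. by elim: N => // N IH; rewrite uS /=; lia. Qed.

Let x N : R := (u N).1%:R.
Let y N : R := (u N).2%:R.

Let y_gt N : N%:R + 1 <= y N.
Proof. by rewrite /y natr1 ler_nat; case/andP: (iteration_bound N). Qed.

Let y_gt0 N : 0 < y N.
Proof. by apply: lt_le_trans (y_gt N); rewrite ltr_wpDl. Qed.

Let x_gt N : y N + 1 <= x N.
Proof. by rewrite /x /y natr1 ler_nat; case/andP: (iteration_bound N). Qed.

Let ratio N := x N / y N.

Let ratio_gt1 N : 1 < ratio N.
Proof. by rewrite /ratio ltr_pdivlMr // mul1r; have := x_gt N; lra. Qed.

(* The map r |-> 1 + 1 / r fixes phi, and r * phi >= 3 / 2 for r >= 1. *)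
Let ratio_dist N : `|ratio N - phi| <= `|ratio 0%N - phi| * (2 / 3) ^+ N.
Proof.
elim: N => [|N IH]; first by rewrite expr0 mulr1.
have ratioS : ratio N.+1 = 1 + (ratio N)^-1.
  have [xN yN] : x N != 0 /\ y N != 0.
    by have := x_gt N; have := y_gt0 N; split; lra.
  have -> : ratio N.+1 = (x N + y N) / x N by rewrite /ratio /x /y uS natrD.
  by rewrite /ratio; field; rewrite xN yN.
have r1 := ratio_gt1 N; have p1 := golden_ratio_gt.
have -> : ratio N.+1 - phi = - (ratio N - phi) / (ratio N * phi).
  (* The fixed point equation of the map, to be subtracted from [ratioS]. *)
  have phiV : phi^-1 = phi - 1.
    have pp := golden_ratio_sqr.
    by apply: (@mulfI _ phi); [|rewrite mulfV]; lra.
  have -> : - (ratio N - phi) / (ratio N * phi) = (ratio N)^-1 - phi^-1.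
    by field; apply/andP; split; lra.
  by rewrite ratioS phiV; lra.
have rp : 3 / 2 <= ratio N * phi by nra.
rewrite normrM normrN normfV (ger0_norm (_ : 0 <= ratio N * phi)); last lra.
rewrite exprSr (mulrA `|_|); apply: ler_pM => //; first by rewrite invr_ge0; lra.
have -> : 2 / 3 = (3 / 2)^-1 :> R by rewrite invf_div.
by rewrite lef_pV2 ?posrE; lra.
Qed.

Lemma cvg_ratio : ratio @ \oo --> phi.
Proof.
pose g := geometric `|ratio 0%N - phi| (2 / 3).
have cvg_g : g @ \oo --> 0 by apply: cvg_geometric; rewrite ger0_norm; lra.
apply: (@squeeze_cvgr _ _ _ _ (fun N => phi - g N) (fun N => phi + g N)).
- by apply: nearW => N; rewrite -ler_distl; exact: ratio_dist.
- by rewrite -[X in _ --> X]subr0; apply: cvgB cvg_g; exact: cvg_cst.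
- by rewrite -[X in _ --> X]addr0; apply: cvgD cvg_g; exact: cvg_cst.
Qed.

(** With [r = a / b], the main term [(a - b) / (2 (a + b))] equals [1 / 2 - 1 / (r + 1)]; the
    probability exceeds it by at most [1 / (N + 1)]. *)
Lemma cvg_transition_prob :
  (fun N => transition_prob R (u N) (u N) (u N.+1)) @ \oo -->
    1 / 2 - 1 / (phi + 1).
Proof.
have p1 := golden_ratio_gt.
pose f N := 1 / 2 - 1 / (ratio N + 1).
have cvf : f @ \oo --> 1 / 2 - 1 / (phi + 1).
  apply: cvgB; first exact: cvg_cst.
  apply: cvgM; first exact: cvg_cst.
  apply: cvgV; first lra.
  by apply: cvgD; [exact: cvg_ratio | exact: cvg_cst].
have cvg_h : (fun N => f N + harmonic N) @ \oo --> 1 / 2 - 1 / (phi + 1).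
  by rewrite -[X in _ --> X]addr0; apply: cvgD => //; exact: cvg_harmonic.
apply: squeeze_cvgr cvf cvg_h; apply: nearW => N.
have := y_gt N; have := y_gt0 N; have := x_gt N.
have := iteration_bound N; rewrite uS /f /ratio /x /y.
case: (u N) => a b /= /andP[Nb ba] xy y0 yN.
have b0 : (0 < b)%N by lia.
rewrite /transition_prob card_attachments // natrM.
have [lo hi] := andP (card_attachments_to_max R a b b0 ba).
move: lo hi; set k := #|` _|; rewrite -!(ler_nat R).
have -> : (4 * (a - b + 1) + 4 = 4 * (a - b) + 8)%N by lia.
have -> : (4 * (a - b + 1) = 4 * (a - b) + 4)%N by lia.
have castE c : (4 * (a - b) + c)%:R = 4 * (a%:R - b%:R) + c%:R :> R.
  by rewrite natrD natrM natrB // ltnW.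
rewrite !castE natrD => lo hi.
have -> : 1 / 2 - 1 / (a%:R / b%:R + 1) =
    4 * (a%:R - b%:R) / (8 * (a%:R + b%:R)) :> R.
  by field; apply/andP; split; lra.
have ab0 : 0 < 8 * (a%:R + b%:R) :> R by lra.
apply/andP; split; first by apply: ler_wpM2r; rewrite ?invr_ge0; lra.
rewrite -lerBlDl -mulrBl ler_pdivrMr //.
(* The count exceeds [4 (a - b)] by at most 8, and [N + 1 <= b] bounds [8 / (8 (a + b))]. *)
apply: (@le_trans _ _ 8); first lra.
by rewrite mulrC ler_pdivlMr ?ltr0Sn // -natr1; lra.
Qed.

End iteration.
End golden_ratio.

(** The iteration starts at index 1, so the limits are taken along the shifted sequence. *)
Lemma golden_limits_iteration (R : realType) (s : nat -> nat * nat) :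
  (0 < (s 1%N).2 < (s 1%N).1)%N ->
  (forall N : nat, s N.+2 = (((s N.+1).1 + (s N.+1).2)%N, (s N.+1).1)) ->
  golden_limits R s.
Proof.
move=> s1 sS; split.
- by rewrite -cvg_shiftS; exact: (cvg_ratio R (fun N => s N.+1)).
- by rewrite -cvg_shiftS; exact: (cvg_transition_prob R (fun N => s N.+1)).
Qed.

(* Part (2) needs 3 <= l.2.  With l = (5, 1) the unique most frequent results
   are (6, 5), (11, 10), (21, 20) and so on, with ratio tending to 1; with
   l.2 = 2 the second step has a tie.  Without that assumption the limits hold
   for the sequence that keeps applying the rule of part (1), which is the last
   conjunct. *)
Theorem proposition7p1 (R : realType) :
  (forall l : nat * nat,
     is_partition l -> (l.2 + 3 < l.1)%N ->
     forall n : nat * nat,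
       highest_result R l l n <-> n = ((l.1 + l.2)%N, l.1))
  /\
  (forall (l : nat * nat) (s : nat -> nat * nat),
     is_partition l -> (l.2 + 3 < l.1)%N -> (3 <= l.2)%N ->
     s 1%N = l ->
     (forall N : nat, (1 <= N)%N -> highest_result R (s N) (s N) (s N.+1)) ->
     golden_limits R s)
  /\
  (forall (l : nat * nat) (s : nat -> nat * nat),
     is_partition l -> (l.2 + 3 < l.1)%N ->
     s 1%N = l ->
     (forall N : nat, (1 <= N)%N ->
        s N.+1 = (((s N).1 + (s N).2)%N, (s N).1)) ->
     golden_limits R s).
Proof.
split; [|split].
- move=> [a b] /= /andP[/= b0 ba] ab n.
  by apply: highest_resultE => //; lia.
- move=> l s /andP[l0 l21] ab b3 s1 sS.
  (* Stated conditionally, so that the induction for [bounds] can use it to compute the next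
     term. *)
  have inv N : (3 <= (s N.+1).2)%N && ((s N.+1).2 + 3 <= (s N.+1).1)%N ->
      s N.+2 = (((s N.+1).1 + (s N.+1).2)%N, (s N.+1).1).
    have := sS N.+1 isT; case: (s N.+1) => a b /= hab /andP[b3' ba].
    by apply: (highest_resultE R a b _ _ _ ba).1 hab; lia.
  have bounds N : (3 <= (s N.+1).2)%N && ((s N.+1).2 + 3 <= (s N.+1).1)%N.
    by elim: N => [|N IH]; [rewrite s1; lia | rewrite (inv _ IH) /=; lia].
  by apply: golden_limits_iteration => [|N]; [rewrite s1; lia | exact: inv].
- move=> l s /andP[l0 l21] ab s1 sS.
  by apply: golden_limits_iteration => [|N]; [rewrite s1; lia | exact: sS].
Qed.
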